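(* Let $k,a,l$ be integers with $1\le a<a+l\le k$. Then for all $n\ge k$, $$c_{a,l}^k(n)=(k-l-1)\,c_{a,l}^k(n-1)+\sum_{j=0}^{\lfloor (n-k)/l\rfloor+1}(-1)^j\binom{n-k+2-(j-1)(l-1)}{j+1}\,c_{a,l}^k(n-1-j).$$
   Context: $S_n$ denotes the set of permutations $\pi=\pi_1\pi_2\cdots\pi_n$ of $\{1,\dots,n\}$ (with $|S_0|=1$). A generalized pattern $\sigma_1\sigma_2\text{-}\sigma_3\text{-}\cdots\text{-}\sigma_k$ with $(\sigma_1,\dots,\sigma_k)\in S_k$ occurs in $\pi\in S_n$ if there are positions $i_1<i_2<\cdots<i_k$ with $i_2=i_1+1$ such that $(\pi_{i_1},\dots,\pi_{i_k})$ is order-isomorphic to $(\sigma_1,\dots,\sigma_k)$ (only the first two letters are required to be adjacent in $\pi$). For $1\le a<a+l\le k$, $C_{a,l}^k$ is the set of all $(k-2)!$ generalized patterns $\sigma_1\sigma_2\text{-}\sigma_3\text{-}\cdots\text{-}\sigma_k$ with $(\sigma_1,\dots,\sigma_k)\in S_k$, $\sigma_1=a$ and $\sigma_2=a+l$. A permutation is $C_{a,l}^k$-avoiding if no pattern in $C_{a,l}^k$ occurs in it. $c_{a,l}^k(n)$ is the number of $C_{a,l}^k$-avoiding permutations in $S_n$. *)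

(* Defs.v *)
From mathcomp Require Import all_boot all_order all_algebra all_fingroup.

Set Implicit Arguments.
Unset Strict Implicit.
Unset Printing Implicit Defensive.

(* Positions and letters are 0-based: pi : 'S_n stands for the word
   pi_1 ... pi_n with pi_(i+1) = (pi i).+1.  A generalized pattern
   sigma_1 sigma_2 - sigma_3 - ... - sigma_k is given by its underlying
   permutation sigma : 'S_k; the adjacency of the first two letters is part of
   the occurrence relation. *)

Definition occurrence (k n : nat) (sigma : 'S_k) (pi : 'S_n)
    (f : {ffun 'I_k -> 'I_n}) : bool :=
  [&& [forall u : 'I_k, forall v : 'I_k, (u < v) ==> (f u < f v)],
      [forall u : 'I_k, forall v : 'I_k,
         ((u == 0 :> nat) && (v == 1 :> nat)) ==> (f v == (f u).+1 :> nat)]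
    & [forall u : 'I_k, forall v : 'I_k,
         (pi (f u) < pi (f v)) == (sigma u < sigma v)]].

Definition occurs (k n : nat) (sigma : 'S_k) (pi : 'S_n) : bool :=
  [exists f : {ffun 'I_k -> 'I_n}, occurrence sigma pi f].

(* C_{a,l}^k: sigma_1 = a and sigma_2 = a + l, in 1-based letters. *)
Definition patterns (k a l : nat) : {set 'S_k} :=
  [set sigma : 'S_k | [forall u : 'I_k,
     ((u == 0 :> nat) ==> ((sigma u).+1 == a)) &&
     ((u == 1 :> nat) ==> ((sigma u).+1 == a + l))]].

Definition avoids (k a l n : nat) (pi : 'S_n) : bool :=
  [forall sigma in patterns k a l, ~~ occurs sigma pi].

Definition c (k a l n : nat) : nat := #|[set pi : 'S_n | avoids k a l pi]|.

(* Main.v *)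
Require Import Defs.
From mathcomp Require Import all_boot all_order all_algebra all_fingroup.
From mathcomp Require Import zify ring.
Import GRing.Theory Num.Theory.

(** All letters of a pattern other than the first two lie to the right of
these two, and their order is unconstrained.  So an occurrence of a pattern of
the family starts at a given position exactly when the two adjacent letters
p < q standing there have, in the suffix that they begin, at least a - 1
letters below p, l - 1 letters between p and q, and k - a - l letters above q.
Avoidance can therefore be tested by deleting first letters one at a time:
a word avoids iff its standardized tail avoids and its first two letters are
not such a pair (avoids_lift_perm).

Let f_N(p) be the number of avoiding words of length N with first letter p.
If p is below a or above N - k + a then no constraint arises and
f_N(p) = c(N - 1) (first_count_free).  Otherwise the words that must be
discarded as tails are those whose first letter lies in an interval, which gives
f_N(p) = c(N - 1) - sum of f_{N-1}(q) for q from p + l - 1 up to a bound that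
depends on N only (first_count_rec).  Hence, if T_N(u) denotes the sum of f_N
over the u largest letters up to N - k + a + l, then
T_N(u + 1) - T_N(u) = c(N - 1) - T_{N-1}(u + 1 - l), where T of a negative
argument is 0.  By Pascal's rule the
alternating binomial sum of the theorem satisfies the same recursion
(alternating_sum_step), so it equals T_N(u) (sum_top_first_counts).
Splitting c(N) according to the first letter, N - k + l + 1 letters contribute
T_N(N - k + l + 1) and each of the k - l - 1 others contributes c(N - 1). *)

(** * Occurrences read by increasing letters *)

Lemma increasing_gap k n (g : 'I_k -> 'I_n) :
    (forall u v : 'I_k, u < v -> g u < g v) ->
  forall u v : 'I_k, u <= v -> g u + (v - u) <= g v.
Proof.
move=> ginc u v; case: v; elim=> [|v IHv] vk /=.
  by move=> u0; rewrite (_ : Ordinal vk = u) ?subnn ?addn0 //; apply: val_inj => /=; lia.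
rewrite leq_eqVlt => /orP[/eqP uv | uv].
  by rewrite (_ : Ordinal vk = u) ?uv ?subnn ?addn0 //; apply: val_inj.
have vk' : v < k by lia.
have := IHv vk' uv; have /= := ginc (Ordinal vk') (Ordinal vk) (ltnSn v).
rewrite /=; move: uv; lia.
Qed.

(** The inverse of tau is the standardization of h: it sends v to the number of
values of h below h v. *)
Lemma sorting_perm k n (h : 'I_k -> 'I_n) :
    injective h ->
  exists tau : 'S_k, forall u v : 'I_k, u < v -> h (tau u) < h (tau v).
Proof.
move=> hinj; pose below v := [set w : 'I_k | h w < h v].
have below_lt v : #|below v| < k.
  rewrite -[k in _ < k]card_ord -cardsT; apply/proper_card/properP.
  by split; [apply: subsetT | exists v; rewrite ?inE ?ltnn].
have below_mono v w : h v <= h w -> #|below v| <= #|below w|.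
  move=> vw; apply/subset_leq_card/subsetP => z; rewrite !inE => zv.
  exact: leq_trans vw.
have below_strict v w : h v < h w -> #|below v| < #|below w|.
  move=> vw; apply/proper_card/properP; split.
    by apply/subsetP => z; rewrite !inE => /ltn_trans; apply.
  by exists v; rewrite ?inE ?ltnn.
pose rank v := Ordinal (below_lt v).
have rank_inj : injective rank.
  move=> v w /(congr1 val) /= E; apply/hinj/val_inj/eqP => /=.
  by rewrite eqn_leq; apply/andP; split; rewrite leqNgt; apply/negP => /below_strict;
     rewrite E ltnn.
exists (perm rank_inj)^-1%g => u v; apply: contraTT; rewrite -!leqNgt => /below_mono.
have rankK z : #|below ((perm rank_inj)^-1%g z)| = z :> nat.
  by rewrite -[in RHS](permKV (perm rank_inj) z) permE.
by rewrite !rankK.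
Qed.

(** An occurrence f of sigma is recorded by h := f \o sigma^-1, the positions of
its letters in increasing order of the letters.  Conversely h determines both
the pattern and the occurrence: the permutation tau that sorts h is the
pattern, and h \o tau is the occurrence.  This removes the quantification over
patterns. *)
Lemma not_avoidsP k n a l (x y : 'I_k) (pi : 'S_n) :
    a = x.+1 -> a + l = y.+1 -> x != y ->
  reflect (exists h : 'I_k -> 'I_n,
      [/\ forall u v : 'I_k, u < v -> pi (h u) < pi (h v),
          h y = (h x).+1 :> nat
        & forall v, v != x -> v != y -> h y < h v])
    (~~ avoids k a l pi).
Proof.
move=> ax ay xy; apply: (iffP idP).
  rewrite negb_forall => /existsP[sigma]; rewrite negb_imply negbK.
  rewrite inE => /andP[/forallP pat /existsP[f]].
  move=> /and3P[/forallP finc /forallP fadj /forallP fiso].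
  have ff (u v : 'I_k) : u < v -> f u < f v.
    by move=> uv; move/forallP: (finc u) => /(_ v) /implyP; apply.
  have fi u v : (pi (f u) < pi (f v)) = (sigma u < sigma v).
    by move/forallP: (fiso u) => /(_ v) /eqP.
  have k1 : 1 < k.
    by move: xy; rewrite -val_eqE /=; have := ltn_ord x; have := ltn_ord y; lia.
  pose u0 := Ordinal (ltnW k1); pose u1 := Ordinal k1.
  have s0 : sigma u0 = x.
    by have /andP[/implyP /(_ isT) /eqP E _] := pat u0; apply/val_inj => /=; lia.
  have s1 : sigma u1 = y.
    by have /andP[_ /implyP /(_ isT) /eqP E] := pat u1; apply/val_inj => /=; lia.
  have sx : sigma^-1%g x = u0 by rewrite -s0 permK.
  have sy : sigma^-1%g y = u1 by rewrite -s1 permK.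
  exists (fun v => f (sigma^-1%g v)); split.
  - by move=> u v uv; rewrite fi !permKV.
  - rewrite sx sy; move/forallP: (fadj u0) => /(_ u1) /implyP /(_ isT) /eqP //.
  - move=> v vx vy; rewrite sy; apply: ff => /=.
    have: sigma^-1%g v != u0 by apply: contra vx => /eqP E; rewrite -s0 -E permKV.
    have: sigma^-1%g v != u1 by apply: contra vy => /eqP E; rewrite -s1 -E permKV.
    rewrite -!val_eqE /=; lia.
move=> [h [hinc hxy hlast]].
have hinj : injective h.
  move=> u v E; case: (ltngtP u v) => [/hinc | /hinc | /val_inj //]; by rewrite E ltnn.
have [tau tauinc] := sorting_perm k n h hinj.
have hx v : v != x -> h x < h v.
  by have [-> | vy /hlast] := eqVneq v y; [rewrite hxy | move/(_ vy); rewrite hxy; lia].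
have tx (u : 'I_k) : u = 0 :> nat -> tau u = x.
  move=> u0; apply/eqP/negPn/negP => /[dup] ux /hx.
  have: u != tau^-1%g x by apply: contra ux => /eqP ->; rewrite permKV.
  rewrite -val_eqE /= => uw.
  have := tauinc u (tau^-1%g x); rewrite permKV; lia.
have ty (u : 'I_k) : u = 1 :> nat -> tau u = y.
  move=> u1; apply/eqP/negPn/negP => uy.
  have ux : tau u != x.
    apply/eqP => E; have k0 : 0 < k by case: (u) => /= m; lia.
    by have := tx (Ordinal k0) erefl; rewrite -E => /perm_inj /(congr1 val) /=; lia.
  have := hlast _ ux uy.
  have w1 : u != tau^-1%g y by apply: contra uy => /eqP ->; rewrite permKV.
  have w0 : tau^-1%g y != 0 :> nat.
    by apply: contra xy => /eqP /tx; rewrite permKV => ->.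
  have := tauinc u (tau^-1%g y); rewrite permKV.
  move: w1 w0; rewrite -val_eqE /=; lia.
rewrite negb_forall; apply/existsP; exists tau; rewrite negb_imply negbK.
apply/andP; split.
  rewrite inE; apply/forallP => u; apply/andP.
  by split; apply/implyP => /eqP E; [rewrite tx // ax | rewrite ty // ay].
apply/existsP; exists [ffun u => h (tau u)]; apply/and3P; split.
- by do 2![apply/forallP => ?]; apply/implyP => /tauinc; rewrite !ffunE.
- apply/forallP => u; apply/forallP => v; apply/implyP => /andP[/eqP u0 /eqP v1].
  by rewrite !ffunE (tx _ u0) (ty _ v1) hxy.
- apply/forallP => u; apply/forallP => v; rewrite !ffunE.
  case: (ltngtP (tau u) (tau v)) => [/hinc -> // | /hinc E | /val_inj /perm_inj ->].
  + by rewrite ltnNge ltnW.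
  + by rewrite ltnn.
Qed.

(** * Deleting the first letter *)

(** With 0-based letters, the three conditions say that at least a - 1 letters
lie below p, at least l - 1 strictly between p and q, and at least k - a - l
above q. *)
Definition forbidden_ascent k a l n p q :=
  [&& a <= p.+1, p + l <= q & q + (k - (a + l)) < n].

Lemma ltn_lift n (p : 'I_n.+1) (i j : 'I_n) : (lift p i < lift p j) = (i < j).
Proof. by rewrite /= !ltnNge leq_bump2. Qed.

(** lift_perm ord0 p s is the word with first letter p whose remaining letters
are order-isomorphic to s.  An occurrence that does not use position 0 is an
occurrence in s; one that uses it forces the gaps of forbidden_ascent, since
its letters increase strictly along h.  Conversely such gaps leave room for an
occurrence, all missing letters being to the right of the first two. *)
Lemma avoids_lift_perm k a l n (p : 'I_n.+1) (s : 'S_n) :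
    0 < a -> 0 < l -> a + l <= k ->
  avoids k a l (lift_perm ord0 p s) =
    avoids k a l s && [forall i : 'I_n, (i == 0 :> nat) ==>
                        ~~ forbidden_ascent k a l n.+1 p (lift p (s i))].
Proof.
move=> a0 l0 alk.
have xk : a.-1 < k by lia.
have yk : (a + l).-1 < k by lia.
pose x := Ordinal xk; pose y := Ordinal yk.
have ax : a = x.+1 by rewrite /=; lia.
have ay : a + l = y.+1 by rewrite /=; lia.
have xy : x != y by rewrite -val_eqE /=; lia.
apply/negb_inj; rewrite negb_and.
apply/(not_avoidsP _ _ _ _ _ _ _ ax ay xy)/orP.
  move=> [h [hinc hxy hlast]].
  case: (unliftP ord0 (h x)) => [x' hx | hx0].
    (* All letters of the occurrence come at or after position h x, so position 0
       is unused. *)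
    left; apply/(not_avoidsP _ _ _ _ _ _ _ ax ay xy).
    have /fin_all_exists[h' hE] : forall v, exists w, h v = lift ord0 w.
      move=> v; case: (unliftP ord0 (h v)) => [w -> | hv]; first by exists w.
      have [E | vx] := eqVneq v x; first by exists x'; rewrite E.
      have [E | vy] := eqVneq v y; first by move: hxy; rewrite -E hv.
      by have := hlast v vx vy; rewrite hv.
    exists h'; split.
    - by move=> u v /hinc; rewrite !hE !lift_perm_lift ltn_lift.
    - by move: hxy; rewrite !hE !lift0 => -[].
    - by move=> v vx vy; have := hlast v vx vy; rewrite !hE ltn_lift.
  right; rewrite negb_forall.
  case: (unliftP ord0 (h y)) => [y' hy | hy0]; last by move: hxy; rewrite hy0.
  apply/existsP; exists y'; rewrite negb_imply negbK.
  have -> : y' == 0 :> nat by move: hxy; rewrite hy hx0 lift0 /=; lia.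
  have gap := increasing_gap _ _ (fun v => lift_perm ord0 p s (h v)) hinc.
  have k0 : 0 < k by lia.
  have k1 : k.-1 < k by lia.
  have := gap (Ordinal k0) x isT; have := gap x y; have := gap y (Ordinal k1).
  rewrite hy hx0 lift_perm_id lift_perm_lift.
  set q := lift p (s y').
  have /= := ltn_ord (lift_perm ord0 p s (h (Ordinal k1))).
  rewrite /forbidden_ascent /= -/q; lia.
case=> [/(not_avoidsP _ _ _ _ _ _ _ ax ay xy)[h [hinc hxy hlast]] | ].
  exists (fun v => lift ord0 (h v)); split.
  - by move=> u v /hinc; rewrite !lift_perm_lift ltn_lift.
  - by rewrite !lift0 hxy.
  - by move=> v vx vy; rewrite ltn_lift hlast.
rewrite negb_forall => /existsP[i]; rewrite negb_imply negbK => /andP[/eqP i0].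
set q := lift p (s i) => /and3P[ap plq qn].
(* The chosen letters: the a - 1 smallest ones, the l letters from p on, q, and
   the k - a - l largest ones. *)
pose g (v : nat) := if v < a.-1 then v else if v < (a + l).-1 then p + (v - a.-1)
   else if v == (a + l).-1 then q : nat else n.+1 - (k - v).
have gn (v : 'I_k) : g v < n.+1.
  by have := ltn_ord v; have := ltn_ord q; rewrite /g; repeat case: ifP; lia.
pose pi := lift_perm ord0 p s.
exists (fun v => pi^-1%g (Ordinal (gn v))).
have hx : pi^-1%g (Ordinal (gn x)) = ord0.
  apply: (@perm_inj _ pi); rewrite permKV lift_perm_id; apply/val_inj.
  by rewrite /= /g /=; repeat case: ifP; lia.
have hy : pi^-1%g (Ordinal (gn y)) = lift ord0 i.
  apply: (@perm_inj _ pi); rewrite permKV lift_perm_lift -/q; apply/val_inj.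
  by rewrite /= /g /=; repeat case: ifP; lia.
have ginc (u v : nat) : v < k -> u < v -> g u < g v.
  by have := ltn_ord p; have := ltn_ord q; rewrite /g; repeat case: ifP; lia.
split.
- by move=> u v uv; rewrite !permKV /= ginc.
- by rewrite hx hy lift0 i0.
move=> v vx vy; rewrite hy lift0 i0.
have inj w z : pi^-1%g (Ordinal (gn w)) = pi^-1%g (Ordinal (gn z)) -> w = z.
  move/perm_inj/(congr1 val) => /= E.
  case: (ltngtP w z) => [lt_wz | lt_zw | /val_inj //].
    by have := ginc w z (ltn_ord z) lt_wz; rewrite E ltnn.
  by have := ginc z w (ltn_ord w) lt_zw; rewrite E ltnn.
have: pi^-1%g (Ordinal (gn v)) != ord0.
  by apply: contra vx => /eqP; rewrite -hx => /inj ->.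
have: pi^-1%g (Ordinal (gn v)) != lift ord0 i.
  by apply: contra vy => /eqP; rewrite -hy => /inj ->.
rewrite -!val_eqE /= /bump /= i0; lia.
Qed.

(** * Counting by the first letter *)

Definition first_count k a l n p :=
  #|[set pi : 'S_n.+1 | avoids k a l pi & pi ord0 == p :> nat]|.

Lemma c_first_letter k a l n :
  c k a l n.+1 = \sum_(p < n.+1) first_count k a l n p.
Proof.
rewrite /c -sum1_card (partition_big (fun pi : 'S_n.+1 => pi ord0) predT) //=.
apply: eq_bigr => p _; rewrite /first_count -sum1_card; apply: eq_bigl => pi.
by rewrite !inE val_eqE.
Qed.

Lemma first_count_lift k a l n (p : 'I_n.+1) :
  first_count k a l n p = #|[set s : 'S_n | avoids k a l (lift_perm ord0 p s)]|.
Proof.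
have linj : injective (lift_perm (ord0 : 'I_n.+1) p).
  move=> s t /permP E; apply/permP => i.
  by have := E (lift ord0 i); rewrite !lift_perm_lift => /lift_inj.
rewrite -(card_imset _ linj) /first_count; congr #|pred_of_set _|.
apply/setP => pi; rewrite !inE; apply/andP/imsetP; last first.
  by case=> s; rewrite inE => ? ->; rewrite lift_perm_id.
case=> avo /eqP/val_inj <-.
have [s E] : exists s, pi = lift_perm ord0 (pi ord0) s.
  pose f i := odflt i (unlift (pi ord0) (pi (lift ord0 i))).
  have fK i : lift (pi ord0) (f i) = pi (lift ord0 i).
    rewrite /f; have := neq_lift ord0 i.
    by rewrite -(inj_eq (@perm_inj _ pi)) => /unlift_some[j E ->].
  have finj : injective f.
    by move=> i j E; apply/(@lift_inj _ ord0)/(@perm_inj _ pi); rewrite -!fK E.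
  exists (perm finj); apply/permP => i.
  by case: (unliftP ord0 i) => [j|] ->; rewrite ?lift_perm_id // lift_perm_lift permE fK.
by exists s; rewrite // inE -E.
Qed.

(** Such a p starts no forbidden ascent whatever letter follows: it has fewer than
a - 1 letters below it, or fewer than k - a above it. *)
Lemma first_count_free k a l n p :
    0 < a -> 0 < l -> a + l <= k -> p <= n ->
    (p.+1 < a) || (n + a < p + k) ->
  first_count k a l n p = c k a l n.
Proof.
move=> a0 l0 alk pn pout.
rewrite (first_count_lift k a l n (Ordinal (pn : p < n.+1))) /c; apply: eq_card => s.
rewrite !inE avoids_lift_perm // andb_idr // => _; apply/forallP => i.
apply/implyP => _; rewrite /forbidden_ascent /=; apply/negP => /and3P[]; lia.
Qed.

Lemma sum_first_count k a l n lo hi :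
  \sum_(lo <= q < hi) first_count k a l n q
    = #|[set s : 'S_n.+1 | avoids k a l s & lo <= s ord0 < hi]|.
Proof.
under eq_bigr => q _.
  rewrite /first_count -sum1_card big_mkcond /=.
  under eq_bigr => s _ do rewrite inE andbC if_and eq_sym.
  over.
rewrite exchange_big /= -sum1_card [RHS]big_mkcond /=; apply: eq_bigr => s _.
rewrite -big_mkcond big_nat1_eq inE.
by case: (avoids k a l s); case: (lo <= s ord0 < hi).
Qed.

(** The sum counts the tails that are to be rejected.  As l > 0, a forbidden
second letter is above p, so it is q + 1 where q is the first letter of the
standardized tail; this accounts for the shift by 1 in the lower bound. *)
Lemma first_count_rec k a l n p :
    0 < a -> 0 < l -> a + l <= k -> p <= n.+1 -> a <= p.+1 ->
  first_count k a l n.+1 p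
    + \sum_(p + l - 1 <= q < n + 1 + a + l - k) first_count k a l n q
  = c k a l n.+1.
Proof.
move=> a0 l0 alk pn ap.
rewrite (first_count_lift k a l n.+1 (Ordinal (pn : p < n.+2))) sum_first_count.
set P := fun s : 'S_n.+1 => p + l - 1 <= s ord0 < n + 1 + a + l - k.
rewrite /c -(cardsID [set s : 'S_n.+1 | P s] [set s | avoids k a l s]) addnC.
congr (_ + _); apply: eq_card => s; rewrite !inE // avoids_lift_perm // andbC.
congr (_ && _).
have -> : P s = forbidden_ascent k a l n.+2 p (lift (Ordinal (pn : p < n.+2)) (s ord0)).
  rewrite /P /forbidden_ascent /= /bump ap /=; have := ltn_ord (s ord0).
  case: leqP => /= ?; lia.
apply/forallP/idP => [/(_ ord0) // | free i].
by apply/implyP => i0; rewrite (_ : i = ord0) //; apply/val_inj/eqP.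
Qed.

(** * The alternating sum *)

(** Pascal's rule survives the truncation of the upper index because the lower
index on the right is positive: for u < b every term is 0. *)
Lemma binS_trunc u b r : 'C(u.+1 - b, r.+2) = 'C(u - b, r.+2) + 'C(u - b, r.+1).
Proof.
case: (leqP b u) => bu; first by rewrite subSn // binS.
have -> : u - b = 0 by lia.
by have -> : u.+1 - b = 0 by lia.
Qed.

Local Open Scope ring_scope.

Definition alternating_sum (f : nat -> nat) l N u J : int :=
  \sum_(j < J) (-1) ^+ j * ('C(u - j * (l - 1), j + 1))%:Z * (f (N - j)%N)%:Z.

Lemma alternating_sum0 f l N J : alternating_sum f l N 0 J = 0.
Proof. by apply: big1 => j _; rewrite sub0n addn1 bin0n mulr0 mul0r. Qed.

(** Pascal's rule splits each binomial coefficient in two: the parts with the same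
lower index give the sum at u, the others the sum for N, shifted by one in j. *)
Lemma alternating_sum_step f l N u J : (0 < l)%N ->
  alternating_sum f l N.+1 u.+1 J.+1
    = alternating_sum f l N.+1 u J.+1 + (f N.+1)%:Z
      - alternating_sum f l N (u.+1 - l) J.
Proof.
move=> l0; rewrite /alternating_sum !big_ord_recl /= !mul0n !subn0 !bin1.
rewrite -!addrA (addrCA _ (f N.+1)%:Z) addrA; congr (_ + _).
  by rewrite expr0 !mul1r; lia.
rewrite -sumrB; apply: eq_bigr => j _.
rewrite /bump /= !add1n addSn addn1 subSS binS_trunc exprS.
have -> : (u - j.+1 * (l - 1) = u.+1 - l - j * (l - 1))%N by rewrite mulSn; lia.
rewrite PoszD; ring.
Qed.

(** Both sides vanish at u = 0 and have the same increment when the next lower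
letter p is added: first_count_rec on the left, alternating_sum_step on the
right.  The words have length d + k - 1.  For d = 0 they are too short to
contain a pattern, and only the term j = 0 remains. *)
Lemma sum_top_first_counts k a l d u :
    (0 < a)%N -> (0 < l)%N -> (a + l <= k)%N -> (u <= d + l)%N ->
  (\sum_(d + a + l - 1 - u <= q < d + a + l - 1)
      first_count k a l (d + k.-2) q)%:Z
    = alternating_sum (c k a l) l (d + k.-2) u d.+1.
Proof.
move=> a0 l0 alk; elim: d u => [|d IHd] u.
  rewrite !add0n => ul; rewrite /alternating_sum big_ord1 expr0 mul1r mul0n !subn0 bin1.
  rewrite (eq_big_nat _ _ (F2 := fun=> c k a l k.-2)); last first.
    by move=> q /andP[qlo qhi]; apply: first_count_free => //; lia.
  rewrite sum_nat_const_nat -PoszM; congr (Posz (_ * _)); lia.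
elim: u => [|u IHu] ul.
  by rewrite alternating_sum0 big_geq // subn0.
rewrite alternating_sum_step // -[(d + k.-2).+1]/(d.+1 + k.-2)%N -IHu; last lia.
rewrite big_ltn; last lia.
rewrite (_ : (d.+1 + a + l - 1 - u.+1).+1 = (d.+1 + a + l - 1 - u))%N; last lia.
set p := (d.+1 + a + l - 1 - u.+1)%N.
have pn : (p <= (d + k.-2).+1)%N by rewrite /p; lia.
have ap : (a <= p.+1)%N by rewrite /p; lia.
have E := first_count_rec k a l (d + k.-2) p a0 l0 alk pn ap.
rewrite addSn -E -IHd; last lia.
have -> : \sum_(p + l - 1 <= q < d + k.-2 + 1 + a + l - k)
              first_count k a l (d + k.-2) q
  = \sum_(d + a + l - 1 - (u.+1 - l) <= q < d + a + l - 1)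
              first_count k a l (d + k.-2) q.
  rewrite (_ : (d + k.-2 + 1 + a + l - k = d + a + l - 1)%N); last lia.
  (* For u + 1 < l the two lower bounds differ, but both intervals are empty. *)
  case: (leqP l u.+1) => lu; first by congr bigop; congr index_iota; rewrite /p; lia.
  by rewrite !big_geq // /p; lia.
rewrite !PoszD; ring.
Qed.

(** The letters below a - 1 and those from d + a + l - 1 on fall under
first_count_free; they are k - l - 1 in number. *)
Lemma c_as_alternating_sum k a l d :
    (0 < a)%N -> (0 < l)%N -> (a + l <= k)%N ->
  (c k a l (d + k.-2).+1)%:Z
    = (k%:Z - l%:Z - 1) * (c k a l (d + k.-2))%:Z
      + alternating_sum (c k a l) l (d + k.-2) (d + l) d.+1.
Proof.
move=> a0 l0 alk; rewrite c_first_letter -sum_top_first_counts //.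
set N := (d + k.-2)%N.
rewrite (_ : d + a + l - 1 - (d + l) = a - 1)%N; last lia.
rewrite -(big_mkord predT (first_count k a l N)).
rewrite (@big_cat_nat _ _ _ (a - 1)) /=; [|lia|rewrite /N; lia].
rewrite (@big_cat_nat _ _ _ (d + a + l - 1) (a - 1)) /=; [|lia|rewrite /N; lia].
have free lo hi : (hi <= N.+1)%N -> (hi < a)%N || (d + a + l - 1 <= lo)%N ->
    \sum_(lo <= q < hi) first_count k a l N q = ((hi - lo) * c k a l N)%N.
  move=> hiN out; rewrite -sum_nat_const_nat; apply: eq_big_nat => q /andP[qlo qhi].
  by apply: first_count_free => //; move: out hiN; rewrite /N; lia.
rewrite (free 0) ?(free (d + a + l - 1)%N) ?leqnn ?orbT //; [|rewrite /N; lia|lia].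
rewrite addnCA addnC -mulnDl PoszD PoszM; congr (_ * _ + _); rewrite /N; lia.
Qed.

Theorem theorem2p4 (k a l : nat) (ha : (1 <= a)%N) (hal : (a < a + l)%N)
    (hk : (a + l <= k)%N) (n : nat) (hn : (k <= n)%N) :
  (c k a l n)%:Z =
    (k%:Z - l%:Z - 1) * (c k a l (n - 1))%:Z
    + \sum_(0 <= j < ((n - k) %/ l + 1).+1)
        (-1) ^+ j
        * ('C(n - k + 2 + (l - 1) - j * (l - 1), j + 1))%:Z
        * (c k a l (n - 1 - j))%:Z.
Proof.
have l0 : (0 < l)%N by lia.
pose d := (n - k + 1)%N.
have nE : n = (d + k.-2).+1 by rewrite /d; lia.
have uE : (n - k + 2 + (l - 1) = d + l)%N by rewrite /d; lia.
rewrite uE {1}nE c_as_alternating_sum // (_ : n - 1 = d + k.-2)%N; last lia.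
congr (_ + _); rewrite /alternating_sum.
have Jle : (((n - k) %/ l + 1).+1 <= d.+1)%N.
  by rewrite ltnS leq_add2r leq_div.
rewrite -(big_mkord predT (fun j => (-1) ^+ j * ('C(d + l - j * (l - 1), j + 1))%:Z
  * (c k a l (d + k.-2 - j))%:Z)).
rewrite (@big_cat_nat _ _ _ ((n - k) %/ l + 1).+1) //=.
(* For j > (n - k) / l + 1 the lower index of the binomial exceeds the upper one. *)
rewrite [X in _ + X]big1_seq ?addr0 // => j /andP[_].
rewrite mem_index_iota => /andP[Jj _].
rewrite bin_small ?mulr0 ?mul0r //.
have := ltn_ceil (n - k) l0.
have := leq_mul Jj (leqnn l).
by rewrite addn1 !mulSn mulnBr muln1 /d; lia.
Qed.
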